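(* Let $\alpha_1,\alpha_2,\gamma_1,\gamma_2\in\mathbb{K}^*$. Every simple right $A_2^{\underline{q},\Lambda}$-module of type $(M_1,\alpha_1,\alpha_2,\gamma_1,\gamma_2)$ has $\mathbb{K}$-dimension $l_1l_2$.
   Context: $\mathbb{K}$ is an algebraically closed field of arbitrary characteristic. $q_1,q_2\in\mathbb{K}\setminus\{0,1\}$ and $\lambda\in\mathbb{K}^*$, where $q_i$ is a primitive $l_i$-th root of unity ($i=1,2$) and $\lambda^{l_1}=1$. All modules are right modules. $A_2^{\underline{q},\Lambda}$ is the unital associative $\mathbb{K}$-algebra generated by $x_1,y_1,x_2,y_2$ subject to $$x_1x_2=q_1\lambda x_2x_1,\quad x_1y_2=\lambda^{-1}y_2x_1,\quad y_1y_2=\lambda y_2y_1,\quad y_1x_2=q_1^{-1}\lambda^{-1}x_2y_1,$$ $$x_1y_1-q_1y_1x_1=1,\qquad x_2y_2-q_2y_2x_2=1+(q_1-1)y_1x_1.$$ Put $z_i=x_iy_i-y_ix_i$ for $i=1,2$; these are normal elements, so each acts on a simple module either as zero (''torsion'') or invertibly (''torsionfree''). The elements $x_1^{l_1},x_2^{l_2},y_1^{l_1},y_2^{l_2},z_1,z_2$ commute with each other. A simple module of type $(M_1,\alpha_1,\alpha_2,\gamma_1,\gamma_2)$ is a simple right $A_2^{\underline{q},\Lambda}$-module $M$ on which $z_1,z_2$ act invertibly and which contains a nonzero common eigenvector $v$ of the six commuting elements $x_1^{l_1},x_2^{l_2},y_1^{l_1},y_2^{l_2},z_1,z_2$ such that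 $vx_i^{l_i}=\alpha_iv$, $vz_i=\gamma_iv$ for $i=1,2$, with $\alpha_1,\alpha_2,\gamma_1,\gamma_2$ nonzero (and $vy_i^{l_i}=\beta_iv$ for some $\beta_i\in\mathbb{K}$). Such an $M$ is denoted $(M_1,\alpha_1,\alpha_2,\gamma_1,\gamma_2)$. *)

(* Defs.v *)
From HB Require Import structures.
From mathcomp Require Import all_boot all_algebra generic_quotient ring_quotient.
From mathcomp Require Import boolp.
From mathcomp Require Import monalg.

Set Implicit Arguments.
Unset Strict Implicit.
Unset Printing Implicit Defensive.

Import GRing.Theory.

Local Open Scope ring_scope.
Local Open Scope quotient_scope.

Section PresentedAlgebra.
Variables (K : comNzRingType) (F : algType K) (rels : F -> Prop).

Inductive gen_ideal : F -> Prop :=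
| gen_ideal_rel r of rels r : gen_ideal r
| gen_ideal0 : gen_ideal 0
| gen_idealB u v of gen_ideal u & gen_ideal v : gen_ideal (u - v)
| gen_idealMl a u of gen_ideal u : gen_ideal (a * u)
| gen_idealMr a u of gen_ideal u : gen_ideal (u * a).

Definition ideal_pred : {pred F} := fun x => `[< gen_ideal x >].

Lemma ideal_predP x : reflect (gen_ideal x) (x \in ideal_pred).
Proof. exact: asboolP. Qed.

Lemma ideal_pred_zmod : zmod_closed ideal_pred.
Proof.
split=> [|u v /ideal_predP hu /ideal_predP hv]; apply/ideal_predP.
  exact: gen_ideal0.
exact: gen_idealB.
Qed.

HB.instance Definition _ := GRing.isZmodClosed.Build F ideal_pred ideal_pred_zmod.

(* The quotient rings of ring_quotient are commutative only, so the ring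
   structure on the additive quotient is built here.  It is a pzRingType:
   nothing prevents the relations from generating the unit ideal. *)
Definition presented : Type := Quotient.quot ideal_pred.

HB.instance Definition _ := Choice.on presented.
HB.instance Definition _ := GRing.Zmodule.on presented.

Definition pres_pi (x : F) : presented := \pi_(Quotient.quot ideal_pred) x.

Lemma pres_piP x y : reflect (pres_pi x = pres_pi y) (x - y \in ideal_pred).
Proof. by rewrite Quotient.idealrBE; exact: eqP. Qed.

Lemma pres_piK (p : presented) : pres_pi (repr (p : Quotient.quot ideal_pred)) = p.
Proof. exact: reprK. Qed.

Lemma pres_pi_zmod : zmod_morphism pres_pi.
Proof. by move=> x y; rewrite /pres_pi !piE. Qed.

HB.instance Definition _ :=
  GRing.isZmodMorphism.Build F presented pres_pi pres_pi_zmod.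

Definition pres_one : presented := pres_pi 1.
Definition pres_mul (p q : presented) : presented :=
  pres_pi (repr (p : Quotient.quot ideal_pred) * repr (q : Quotient.quot ideal_pred)).
Definition pres_scale (c : K) (p : presented) : presented :=
  pres_pi (c *: repr (p : Quotient.quot ideal_pred)).

Lemma pres_piM x y : pres_mul (pres_pi x) (pres_pi y) = pres_pi (x * y).
Proof.
set p := pres_pi x; set q := pres_pi y; apply/pres_piP.
have /pres_piP/ideal_predP hx : pres_pi (repr (p : Quotient.quot ideal_pred)) = pres_pi x
  by rewrite pres_piK.
have /pres_piP/ideal_predP hy : pres_pi (repr (q : Quotient.quot ideal_pred)) = pres_pi y
  by rewrite pres_piK.
rewrite -(subrKA (x * repr (q : Quotient.quot ideal_pred))) -mulrBl -mulrBr.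
by apply: rpredD; apply/ideal_predP; [exact: gen_idealMr|exact: gen_idealMl].
Qed.

Lemma pres_piZ c x : pres_scale c (pres_pi x) = pres_pi (c *: x).
Proof.
set p := pres_pi x; apply/pres_piP.
have /pres_piP/ideal_predP hx : pres_pi (repr (p : Quotient.quot ideal_pred)) = pres_pi x
  by rewrite pres_piK.
rewrite -scalerBr -mulr_algl.
by apply/ideal_predP; exact: gen_idealMl.
Qed.

Lemma pres_ind (P : presented -> Prop) :
  (forall x, P (pres_pi x)) -> forall p, P p.
Proof. by move=> hP p; rewrite -(pres_piK p). Qed.

Fact pres_mulA : associative pres_mul.
Proof.
by elim/pres_ind=> x; elim/pres_ind=> y; elim/pres_ind=> z; rewrite !pres_piM mulrA.
Qed.

Fact pres_mul1 : left_id pres_one pres_mul.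
Proof. by elim/pres_ind=> x; rewrite pres_piM mul1r. Qed.

Fact pres_mulr1 : right_id pres_one pres_mul.
Proof. by elim/pres_ind=> x; rewrite pres_piM mulr1. Qed.

Fact pres_mulDl : left_distributive pres_mul +%R.
Proof.
elim/pres_ind=> x; elim/pres_ind=> y; elim/pres_ind=> z.
by rewrite -raddfD !pres_piM mulrDl raddfD.
Qed.

Fact pres_mulDr : right_distributive pres_mul +%R.
Proof.
elim/pres_ind=> x; elim/pres_ind=> y; elim/pres_ind=> z.
by rewrite -raddfD !pres_piM mulrDr raddfD.
Qed.

HB.instance Definition _ := GRing.Zmodule_isPzRing.Build presented
  pres_mulA pres_mul1 pres_mulr1 pres_mulDl pres_mulDr.

Fact pres_scaleA a b p : pres_scale a (pres_scale b p) = pres_scale (a * b) p.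
Proof. by elim/pres_ind: p => x; rewrite !pres_piZ scalerA. Qed.

Fact pres_scale1 : left_id 1 pres_scale.
Proof. by elim/pres_ind=> x; rewrite pres_piZ scale1r. Qed.

Fact pres_scaleDr : right_distributive pres_scale +%R.
Proof.
move=> a; elim/pres_ind=> x; elim/pres_ind=> y.
by rewrite -raddfD !pres_piZ scalerDr raddfD.
Qed.

Fact pres_scaleDl p : {morph pres_scale^~ p : a b / a + b}.
Proof.
by move=> a b; elim/pres_ind: p => x; rewrite /= !pres_piZ scalerDl raddfD.
Qed.

HB.instance Definition _ := GRing.Zmodule_isLmodule.Build K presented
  pres_scaleA pres_scale1 pres_scaleDr pres_scaleDl.

Lemma pres_pi_monoid : monoid_morphism pres_pi.
Proof. by split=> // x y; rewrite -pres_piM. Qed.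

HB.instance Definition _ :=
  GRing.isMonoidMorphism.Build F presented pres_pi pres_pi_monoid.

Lemma pres_pi_scalable : scalable pres_pi.
Proof. by move=> c x; rewrite -pres_piZ. Qed.

HB.instance Definition _ :=
  GRing.isScalable.Build K F presented *:%R pres_pi pres_pi_scalable.

Lemma pres_scaleAl (c : K) (p q : presented) : c *: (p * q) = (c *: p) * q.
Proof.
elim/pres_ind: p => x; elim/pres_ind: q => y.
by rewrite -rmorphM -!pres_pi_scalable -rmorphM scalerAl.
Qed.

Lemma pres_scaleAr (c : K) (p q : presented) : c *: (p * q) = p * (c *: q).
Proof.
elim/pres_ind: p => x; elim/pres_ind: q => y.
by rewrite -rmorphM -!pres_pi_scalable -rmorphM scalerAr.
Qed.

Lemma pres_rel u v : rels (u - v) -> pres_pi u = pres_pi v.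
Proof. by move=> h; apply/pres_piP/ideal_predP; exact: gen_ideal_rel. Qed.

End PresentedAlgebra.

Section FreeAlgebra.
Variables (K : comNzRingType) (I : choiceType).

Lemma malgC_comm (c : K) (u : {malg K[{fmonom I}]}) : c%:MP * u = u * c%:MP.
Proof.
rewrite [u]monalgE mulr_suml mulr_sumr; apply: eq_bigr => j _.
have UM (a b : K) (m n : {fmonom I}) :
    << a *g m >> * << b *g n >> = << a * b *g mmul m n >> := fgmulUU a b m n.
by rewrite !UM mul1m mulm1 mulrC.
Qed.

Lemma free_scaleAr c (u v : {malg K[{fmonom I}]}) : c *: (u * v) = u * (c *: v).
Proof.
have scaleE (w : {malg K[{fmonom I}]}) : c *: w = c%:MP * w.
  by rewrite mul_malgC.
by rewrite (scaleE (u * v)) (scaleE v) mulrA malgC_comm -mulrA.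
Qed.

(* A named copy: monalg already has a canonical algType instance on malg,
   reserved to commutative monomials. *)
Definition free_alg : Type := {malg K[{fmonom I}]}.

HB.instance Definition _ := GRing.Lalgebra.on free_alg.
HB.instance Definition _ := GRing.Lalgebra_isAlgebra.Build K free_alg free_scaleAr.

Definition free_gen (i : I) : free_alg := << fmu i >>.

End FreeAlgebra.

Section QuantizedWeylAlgebra.
Variables (K : fieldType) (q1 q2 lam : K).

Local Notation F := (free_alg K 'I_4).
Local Notation X1 := (free_gen K (inord 0 : 'I_4)).
Local Notation Y1 := (free_gen K (inord 1 : 'I_4)).
Local Notation X2 := (free_gen K (inord 2 : 'I_4)).
Local Notation Y2 := (free_gen K (inord 3 : 'I_4)).

(* A relation u = v is encoded by the relator u - v. *)
Inductive qweyl_rel : F -> Prop :=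
| qweyl_x1x2 : qweyl_rel (X1 * X2 - (q1 * lam) *: (X2 * X1))
| qweyl_x1y2 : qweyl_rel (X1 * Y2 - lam^-1 *: (Y2 * X1))
| qweyl_y1y2 : qweyl_rel (Y1 * Y2 - lam *: (Y2 * Y1))
| qweyl_y1x2 : qweyl_rel (Y1 * X2 - (q1^-1 * lam^-1) *: (X2 * Y1))
| qweyl_x1y1 : qweyl_rel (X1 * Y1 - q1 *: (Y1 * X1) - 1)
| qweyl_x2y2 :
    qweyl_rel (X2 * Y2 - q2 *: (Y2 * X2) - (1 + (q1 - 1) *: (Y1 * X1))).

Definition qweyl : Type := presented qweyl_rel.

HB.instance Definition _ := GRing.PzRing.on qweyl.
HB.instance Definition _ := GRing.Lmodule.on qweyl.

Definition x1 : qweyl := pres_pi qweyl_rel X1.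
Definition y1 : qweyl := pres_pi qweyl_rel Y1.
Definition x2 : qweyl := pres_pi qweyl_rel X2.
Definition y2 : qweyl := pres_pi qweyl_rel Y2.
Definition z1 : qweyl := x1 * y1 - y1 * x1.
Definition z2 : qweyl := x2 * y2 - y2 * x2.

End QuantizedWeylAlgebra.

Section QweylFacts.
Variables (K : fieldType) (q1 q2 lam : K).

Local Notation A := (qweyl q1 q2 lam).
Local Notation x1 := (x1 q1 q2 lam).
Local Notation y1 := (y1 q1 q2 lam).
Local Notation x2 := (x2 q1 q2 lam).
Local Notation y2 := (y2 q1 q2 lam).
Local Notation pi := (pres_pi (qweyl_rel q1 q2 lam)).

Let piM u v : (pi u : A) * pi v = pi (u * v).
Proof. by rewrite [RHS]rmorphM. Qed.

Let piD u v : (pi u : A) + pi v = pi (u + v).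
Proof. by rewrite [RHS]raddfD. Qed.

Let piB u v : (pi u : A) - pi v = pi (u - v).
Proof. by rewrite [RHS]raddfB. Qed.

Let piZ c u : c *: (pi u : A) = pi (c *: u).
Proof. by rewrite [RHS]pres_pi_scalable. Qed.

Let pi1 : (1 : A) = pi 1.
Proof. by []. Qed.

Lemma mul_x1x2 : x1 * x2 = (q1 * lam) *: (x2 * x1).
Proof. by rewrite !piM piZ; apply: pres_rel; exact: qweyl_x1x2. Qed.

Lemma mul_x1y2 : x1 * y2 = lam^-1 *: (y2 * x1).
Proof. by rewrite !piM piZ; apply: pres_rel; exact: qweyl_x1y2. Qed.

Lemma mul_y1y2 : y1 * y2 = lam *: (y2 * y1).
Proof. by rewrite !piM piZ; apply: pres_rel; exact: qweyl_y1y2. Qed.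

Lemma mul_y1x2 : y1 * x2 = (q1^-1 * lam^-1) *: (x2 * y1).
Proof. by rewrite !piM piZ; apply: pres_rel; exact: qweyl_y1x2. Qed.

Lemma mul_x1y1 : x1 * y1 - q1 *: (y1 * x1) = 1.
Proof. by rewrite !piM piZ piB pi1; apply: pres_rel; exact: qweyl_x1y1. Qed.

Lemma mul_x2y2 : x2 * y2 - q2 *: (y2 * x2) = 1 + (q1 - 1) *: (y1 * x1).
Proof.
by rewrite !piM !piZ piB pi1 piD; apply: pres_rel; exact: qweyl_x2y2.
Qed.

Lemma qweyl_ind (P : A -> Prop) :
  P 1 -> (forall a b, P a -> P b -> P (a + b)) -> (forall c a, P a -> P (c *: a)) ->
  (forall a, P a -> P (x1 * a)) -> (forall a, P a -> P (y1 * a)) ->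
  (forall a, P a -> P (x2 * a)) -> (forall a, P a -> P (y2 * a)) ->
  forall a, P a.
Proof.
move=> h1 hD hZ p1 p2 p3 p4; elim/pres_ind => u.
have h0 : P 0 by move: (hZ 0 1 h1); rewrite scale0r.
have UM (m n : {fmonom 'I_4}) :
    (<< m >> : {malg K[{fmonom 'I_4}]})  * << n >> = << mmul m n >>.
  by rewrite -[1 in RHS]mulr1; exact: fgmulUU.
have hm (m : {fmonom 'I_4}) : P (pi << m >>).
  case: m => s; elim: s => [|i s IH].
    by rewrite -[FMonom [::]]fmoneE; exact: h1.
  have -> : FMonom (i :: s) = mmul (fmu i) (FMonom s).
    by apply/val_inj; rewrite /= fmM fmU.
  rewrite -UM -piM.
  have -> : i = inord i by rewrite inord_val.
  case: i => [[|[|[|[|//]]]] ?]; [exact: p1|exact: p2|exact: p3|exact: p4].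
rewrite (monalgE u) raddf_sum /=.
elim/big_rec: _ => // m b _ hb. apply: (hD) => //.
have -> : << u@_m *g m >> = u@_m *: (<<m>> : {malg K[{fmonom 'I_4}]}) :> free_alg K 'I_4.
  by apply/malgP => k; rewrite mcoeffZ !mcoeffU mulrnAr mulr1.
by rewrite -(piZ u@_m << m >>); exact: hZ.
Qed.

End QweylFacts.

(* A right A-module is a left module over the converse ring A^c. *)
Definition ract (A : pzRingType) (M : lmodType A^c) (m : M) (a : A) : M :=
  (a : A^c) *: m.

Definition simple_mod (R : pzRingType) (M : lmodType R) : Prop :=
  (exists m : M, m != 0) /\
  forall N : {pred M}, submod_closed N ->
    (forall m, m \in N -> m = 0) \/ (forall m, m \in N).

Section QweylModules.
Variables (K : fieldType) (q1 q2 lam : K).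

Local Notation A := (qweyl q1 q2 lam).
Local Notation x1 := (x1 q1 q2 lam).
Local Notation y1 := (y1 q1 q2 lam).
Local Notation x2 := (x2 q1 q2 lam).
Local Notation y2 := (y2 q1 q2 lam).
Local Notation z1 := (z1 q1 q2 lam).
Local Notation z2 := (z2 q1 q2 lam).

Variable M : lmodType A^c.

(* The K-vector space structure of M is the one induced by the scalars of A. *)
Definition kscale (c : K) (m : M) : M := ract m (c *: (1 : A)).

Definition kdim (n : nat) : Prop :=
  exists e : 'I_n -> M,
    (forall c : 'I_n -> K, \sum_(i < n) kscale (c i) (e i) = 0 ->
       forall i, c i = 0) /\
    (forall m : M, exists c : 'I_n -> K, m = \sum_(i < n) kscale (c i) (e i)).

Definition type_M1 (l1 l2 : nat) (a1 a2 g1 g2 : K) : Prop :=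
  [/\ simple_mod M,
      bijective (fun m : M => ract m z1),
      bijective (fun m : M => ract m z2) &
      exists v : M, v != 0 /\
        [/\ ract v (x1 ^+ l1) = kscale a1 v,
            ract v (x2 ^+ l2) = kscale a2 v,
            exists b1, ract v (y1 ^+ l1) = kscale b1 v,
            exists b2, ract v (y2 ^+ l2) = kscale b2 v &
            ract v z1 = kscale g1 v /\ ract v z2 = kscale g2 v]].

End QweylModules.

(* Main.v *)
From HB Require Import structures.
Require Import Defs.
From mathcomp Require Import all_boot all_algebra.
From mathcomp Require Import boolp.

(** The vectors [v x1^i x2^j] are joint eigenvectors of [z1] and [z2] with
    eigenvalues [q1^i g1] and [q1^i q2^j g2], so those with [i < l1], [j < l2]
    are linearly independent.  Their span is stable under [x1] and [x2] because
    [v x1^l1 = a1 v] and [v x2^l2 = a2 v], and stable under [y1] and [y2]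
    because [(q1 - 1) x1 y1 = q1 z1 - 1] and [(q2 - 1) x2 y2 = q2 z2 - z1] act
    diagonally.  By simplicity this span is the whole module. *)

Set Implicit Arguments.
Unset Strict Implicit.
Unset Printing Implicit Defensive.

Import GRing.Theory.

Local Open Scope ring_scope.

(** * Spans of finite families and independence of joint eigenvectors *)

Section LinearSpan.
Variables (K : fieldType) (V : lmodType K) (n : nat) (e : 'I_n -> V).

Definition lspan m := exists c : 'I_n -> K, m = \sum_(i < n) c i *: e i.

Lemma lspan_gen i : lspan (e i).
Proof.
exists (fun j => (j == i)%:R); rewrite (bigD1 i) //= eqxx scale1r big1 ?addr0 //.
by move=> j /negbTE ->; rewrite scale0r.
Qed.

Lemma lspan0 : lspan 0.
Proof. by exists (fun=> 0); rewrite big1 // => i _; rewrite scale0r. Qed.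

Lemma lspanD m m' : lspan m -> lspan m' -> lspan (m + m').
Proof.
move=> [c ->] [c' ->]; exists (fun i => c i + c' i).
by rewrite -big_split /=; apply: eq_bigr => i _; rewrite scalerDl.
Qed.

Lemma lspanZ c m : lspan m -> lspan (c *: m).
Proof.
move=> [d ->]; exists (fun i => c * d i).
by rewrite scaler_sumr; apply: eq_bigr => i _; rewrite scalerA.
Qed.

Lemma lspan_linear (f : {linear V -> V}) m :
  (forall i, lspan (f (e i))) -> lspan m -> lspan (f m).
Proof.
move=> fe [c ->]; rewrite linear_sum /=.
apply: big_ind => [||i _]; [exact: lspan0 | exact: lspanD |].
by rewrite linearZ; exact: lspanZ.
Qed.

Lemma joint_eigenvectors_free (J : Type) (f : J -> {linear V -> V})
    (mu : J -> 'I_n -> K) :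
  (forall i, e i != 0) ->
  (forall t i, f t (e i) = mu t i *: e i) ->
  (forall i k, k != i -> exists t, mu t i != mu t k) ->
  forall c : 'I_n -> K, \sum_(i < n) c i *: e i = 0 -> forall i, c i = 0.
Proof.
move=> e_neq0 fe mu_sep c sum0 i.
(* The product of suitable [f t - mu t k], [k != i], kills every [e k] but [e i]. *)
have [w [s [we sk si]]] : exists (w : {linear V -> V}) (s : 'I_n -> K),
    [/\ forall j, w (e j) = s j *: e j,
        forall k, k \in enum 'I_n -> k != i -> s k = 0 & s i != 0].
  elim: (enum 'I_n) => [|k r [w [s [we sk si]]]].
    exists idfun, (fun=> 1); split=> //; last exact: oner_neq0.
    by move=> j; rewrite scale1r.
  have [->|ki] := eqVneq k i.
    exists w, s; split=> // k'; rewrite inE => /orP[/eqP ->|]; last exact: sk.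
    by rewrite eqxx.
  have [t mu_neq] := mu_sep i k ki.
  exists ((f t \- *:%R (mu t k)) \o w), (fun j => s j * (mu t j - mu t k)); split.
  - move=> j /=; rewrite we linearZ /= fe -scalerA scalerBl scalerBr.
    by congr (_ - _); rewrite !scalerA mulrC.
  - move=> k'; rewrite inE => /orP[/eqP -> _|k'r k'i]; first by rewrite subrr mulr0.
    by rewrite sk ?mul0r.
  - by rewrite mulf_neq0 // subr_eq0.
(* Applying [w] to the vanishing sum leaves only the [i]-th term. *)
have: (s i * c i) *: e i = 0.
  rewrite -(linear0 w) -sum0 linear_sum /= (bigD1 i) //= big1 ?addr0.
    by rewrite linearZ /= we scalerA mulrC.
  by move=> k ki; rewrite linearZ /= we sk ?mem_enum // scale0r scaler0.
by move/eqP; rewrite scaler_eq0 mulf_eq0 (negbTE si) (negbTE (e_neq0 i)) orbF => /eqP.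
Qed.

End LinearSpan.

(** * Linear maps that commute up to a scalar *)

Section LinearQcommutation.
Variables (K : fieldType) (V : lmodType K).
Implicit Types (f g : {linear V -> V}) (c : K) (m : V).

Lemma iter_linearZ f i c m : iter i f (c *: m) = c *: iter i f m.
Proof. by elim: i => //= i ->; rewrite linearZ. Qed.

Lemma iter_linear0 f i : iter i f 0 = 0.
Proof. by elim: i => //= i ->; rewrite linear0. Qed.

Lemma qcomm_iterr (f : V -> V) g c i m : (forall m, f (g m) = c *: g (f m)) ->
  f (iter i g m) = c ^+ i *: iter i g (f m).
Proof.
move=> fg; elim: i => [|i IH] /=; first by rewrite expr0 scale1r.
by rewrite fg IH linearZ scalerA -exprS.
Qed.

Lemma qcomm_iter f g c i j m : (forall m, f (g m) = c *: g (f m)) ->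
  iter j f (iter i g m) = (c ^+ i) ^+ j *: iter i g (iter j f m).
Proof.
move=> fg; elim: j => [|j IH] /=; first by rewrite expr0 scale1r.
by rewrite IH linearZ /= (qcomm_iterr _ _ fg) scalerA -exprSr.
Qed.

Lemma qcommV f g c m : c != 0 -> f (g m) = c *: g (f m) ->
  g (f m) = c^-1 *: f (g m).
Proof. by move=> c0 ->; rewrite scalerA mulVf // scale1r. Qed.

Lemma qweyl_commutator f g (w : V -> V) q m :
  (forall m, g (f m) = w m + q *: f (g m)) -> w (f m) = f (w m) ->
  g (f (f m)) - f (g (f m)) = q *: f (g (f m) - f (g m)).
Proof.
move=> gf wf; rewrite [g (f (f m))]gf wf linearB scalerBr.
have gfE : f (g (f m)) = f (w m) + q *: f (f (g m)).
  by rewrite gf linearD linearZ.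
by rewrite {2}gfE opprD addrACA subrr add0r.
Qed.

(** Eliminating [f (g m)] between the relation and the commutator makes [g] after [f] diagonal
    wherever the commutator and [w] are. *)
Lemma qweyl_product f g (w : V -> V) q m : g (f m) = w m + q *: f (g m) ->
  (q - 1) *: g (f m) = q *: (g (f m) - f (g m)) - w m.
Proof.
move=> gf; rewrite scalerBr scalerBl scale1r {2}gf opprD.
by rewrite addrA [RHS]addrAC.
Qed.

End LinearQcommutation.

(** * The quantized Weyl relations as operators on a vector space *)

Section QweylOperators.
Variables (K : fieldType) (V : lmodType K) (q1 q2 lam : K) (l1 l2 : nat).
Variables (a1 a2 g1 g2 : K).
(* The operators act on the right, so the relation [x1 x2 = q1 lam x2 x1] reads
   [x2 (x1 m) = q1 lam (x1 (x2 m))]. *)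
Variables (x1 y1 x2 y2 : {linear V -> V}).
Hypotheses (q1_neq1 : q1 != 1) (q2_neq1 : q2 != 1).
Hypotheses (q1_neq0 : q1 != 0) (lam_neq0 : lam != 0).
Hypotheses (q1_prim : l1.-primitive_root q1) (q2_prim : l2.-primitive_root q2).
Hypotheses (a1_neq0 : a1 != 0) (a2_neq0 : a2 != 0).
Hypotheses (g1_neq0 : g1 != 0) (g2_neq0 : g2 != 0).
Hypotheses
  (x1x2 : forall m, x2 (x1 m) = (q1 * lam) *: x1 (x2 m))
  (x1y2 : forall m, y2 (x1 m) = lam^-1 *: x1 (y2 m))
  (y1x2 : forall m, x2 (y1 m) = (q1^-1 * lam^-1) *: y1 (x2 m))
  (x1y1 : forall m, y1 (x1 m) = m + q1 *: x1 (y1 m)).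

Let z1 : {linear V -> V} := (y1 \o x1) \- (x1 \o y1).
Let z2 : {linear V -> V} := (y2 \o x2) \- (x2 \o y2).

(** By [x1y1], [z1] equals [1 + (q1 - 1) y1 x1]. Written this way, the relation has the shape of
    [x1y1] with [z1] in place of the identity. *)
Hypothesis x2y2 : forall m, y2 (x2 m) = z1 m + q2 *: x2 (y2 m).

Let q1lam_neq0 : q1 * lam != 0. Proof. exact: mulf_neq0. Qed.

Let x2x1 m : x1 (x2 m) = (q1 * lam)^-1 *: x2 (x1 m).
Proof. exact: qcommV. Qed.

Let x2y1 m : y1 (x2 m) = (q1 * lam) *: x2 (y1 m).
Proof. by rewrite y1x2 scalerA -invfM mulfV // scale1r. Qed.

Let z1E m : z1 m = m + (q1 - 1) *: x1 (y1 m).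
Proof. by rewrite /z1 /= x1y1 scalerBl scale1r addrA. Qed.

Let z2E m : z2 m = z1 m + (q2 - 1) *: x2 (y2 m).
Proof. by rewrite {1}/z2 /= x2y2 scalerBl scale1r addrA. Qed.

Lemma qweyl_z1x1 m : z1 (x1 m) = q1 *: x1 (z1 m).
Proof. exact: (qweyl_commutator (w := id)). Qed.

(** In [z1 = 1 + (q1 - 1) y1 x1], the scalars from moving [x2] past [y1] and past [x1] are mutually
    inverse. *)
Lemma qweyl_z1x2 m : z1 (x2 m) = x2 (z1 m).
Proof.
rewrite !z1E x2y1 linearD !linearZ /= x2x1 !scalerA.
by rewrite [q1 * lam * _]mulrC mulfK.
Qed.

Lemma qweyl_z2x2 m : z2 (x2 m) = q2 *: x2 (z2 m).
Proof. by apply: (qweyl_commutator (w := z1)) => //; exact: qweyl_z1x2. Qed.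

(** In [z2 = z1 + (q2 - 1) y2 x2], the first summand contributes [q1], and in the second the scalars
    [lam^-1] and [q1 lam] multiply to [q1] as well. *)
Lemma qweyl_z2x1 m : z2 (x1 m) = q1 *: x1 (z2 m).
Proof.
rewrite !z2E qweyl_z1x1 x1y2 !linearD !linearZ /= x1x2 !scalerA.
by rewrite [q1 * lam]mulrC mulrACA mulVf // mul1r.
Qed.

Variable v : V.
Hypotheses (v_neq0 : v != 0).
Hypotheses (vx1 : iter l1 x1 v = a1 *: v) (vx2 : iter l2 x2 v = a2 *: v).
Hypotheses (vz1 : z1 v = g1 *: v) (vz2 : z2 v = g2 *: v).

Let l1_gt0 : (0 < l1)%N. Proof. exact: prim_order_gt0 q1_prim. Qed.
Let l2_gt0 : (0 < l2)%N. Proof. exact: prim_order_gt0 q2_prim. Qed.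

(** The indices range over all naturals, so that [x1] and [x2] act as shifts up to a scalar;
    periodicity brings them back into range. *)
Let e i j : V := iter j x2 (iter i x1 v).

Let ex1 i j : x1 (e i j) = (q1 * lam)^-1 ^+ j *: e i.+1 j.
Proof. exact: qcomm_iterr. Qed.

Let e_per1 i j : e (l1 + i) j = a1 *: e i j.
Proof. by rewrite /e addnC iterD vx1 !iter_linearZ. Qed.

(** Moving [x2^l2] past [x1^i] to reach [v] costs [(q1 lam)^(i l2)], so the multiplier of a period
    in [j] depends on [i]. *)
Let c2 i := (q1 * lam) ^+ i ^+ l2 * a2.

Let e_per2 i j : e i (l2 + j) = c2 i *: e i j.
Proof.
by rewrite /e addnC iterD (qcomm_iter _ _ _ x1x2) vx2 !iter_linearZ scalerA.
Qed.

Let c2_neq0 i : c2 i != 0.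
Proof. by rewrite mulf_neq0 ?expf_neq0. Qed.

(** If the next vector vanished, so would the one a full period ahead, which is a nonzero multiple
    of the current one. *)
Let e_neq0 i j : e i j != 0.
Proof.
elim: j => [|j].
  elim: i => [//|i]; apply: contra_neq => e0; apply: (scalerI a1_neq0).
  rewrite scaler0 -e_per1 -(prednK l1_gt0) addSnnS /e /= iterD.
  by rewrite [iter i.+1 _ _]e0 iter_linear0.
apply: contra_neq => e0; apply: (scalerI (c2_neq0 i)).
rewrite scaler0 -e_per2 -(prednK l2_gt0) addSnnS /e iterD.
by rewrite [iter j.+1 _ _]e0 iter_linear0.
Qed.

Let ez1 i j : z1 (e i j) = (q1 ^+ i * g1) *: e i j.
Proof.
rewrite /e (@qcomm_iterr _ _ _ _ 1) => [|m]; last by rewrite scale1r qweyl_z1x2.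
rewrite expr1n scale1r (qcomm_iterr _ _ qweyl_z1x1) vz1.
by rewrite !iter_linearZ scalerA.
Qed.

Let ez2 i j : z2 (e i j) = (q1 ^+ i * q2 ^+ j * g2) *: e i j.
Proof.
rewrite /e (qcomm_iterr _ _ qweyl_z2x2) (qcomm_iterr _ _ qweyl_z2x1) vz2.
by rewrite !iter_linearZ !scalerA [q2 ^+ j * _]mulrC.
Qed.

Let E (k : 'I_(l1 * l2)) := e (k %/ l2) (k %% l2).

Let eE i j : lspan E (e i j).
Proof.
(* Full periods are stripped from both indices; the remainders give the member of [E] at position
   [i * l2 + j]. *)
rewrite (divn_eq i l1) (divn_eq j l2).
elim: (j %/ l2)%N => [|jq IHj]; last first.
  by rewrite mulSn -addnA e_per2; exact: lspanZ.
elim: (i %/ l1)%N => [|iq IHi]; last first.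
  by rewrite mulSn -addnA e_per1; exact: lspanZ.
rewrite !mul0n !add0n.
have lt : (i %% l1 * l2 + j %% l2 < l1 * l2)%N.
  by rewrite -ltn_divLR // divnMDl // divn_small ?ltn_mod // addn0 ltn_mod.
have := lspan_gen E (Ordinal lt); rewrite /E /=.
by rewrite divnMDl // divn_small ?ltn_mod // addn0 modnMDl modn_mod.
Qed.

Let ey1 i j : lspan E (y1 (e i j)).
Proof.
(* Going round a full period exhibits [e i j] as a multiple of a vector in the image of [x1], where
   [y1] is computed by [qweyl_product]. *)
have -> : e i j = a1^-1 *: e (l1.-1 + i).+1 j.
  by rewrite -addSn prednK // e_per1 scalerA mulVf // scale1r.
have cj0 : (q1 * lam)^-1 ^+ j != 0 by rewrite expf_neq0 ?invr_neq0.
have -> : e (l1.-1 + i).+1 j = ((q1 * lam)^-1 ^+ j)^-1 *: x1 (e (l1.-1 + i) j).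
  by rewrite ex1 scalerA mulVf // scale1r.
rewrite !linearZ; do 2!apply: lspanZ.
have q1B : q1 - 1 != 0 by rewrite subr_eq0.
rewrite /= -[y1 _]scale1r -(mulVf q1B) -scalerA (qweyl_product (w := id)) //.
rewrite -[_ - x1 _]/(z1 _) ez1 scalerA -{2}[e _ _]scale1r -scalerBl.
by do 2!apply: lspanZ.
Qed.

Let ey2 i j : lspan E (y2 (e i j)).
Proof.
have -> : e i j = (c2 i)^-1 *: e i (l2.-1 + j).+1.
  by rewrite -addSn prednK // e_per2 scalerA mulVf // scale1r.
(* No extra scalar arises here, since [x2] is applied last in [e]. *)
rewrite linearZ; apply: lspanZ; rewrite -[e _ _]/(x2 (e i (l2.-1 + j))).
have q2B : q2 - 1 != 0 by rewrite subr_eq0.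
rewrite /= -[y2 _]scale1r -(mulVf q2B) -scalerA (qweyl_product (w := z1)) //.
rewrite -[_ - x2 _]/(z2 _) ez1 ez2 scalerA -scalerBl.
by do 2!apply: lspanZ.
Qed.

Let E_free (c : 'I_(l1 * l2) -> K) :
  \sum_(k < l1 * l2) c k *: E k = 0 -> forall k, c k = 0.
Proof.
pose mu t (k : 'I_(l1 * l2)) : K := if t then q1 ^+ (k %/ l2) * g1
  else q1 ^+ (k %/ l2) * q2 ^+ (k %% l2) * g2.
apply: (@joint_eigenvectors_free _ _ _ E _ (fun t : bool => if t then z1 else z2) mu).
- by move=> k; exact: e_neq0.
- by case=> k; [exact: ez1 | exact: ez2].
(* Different quotients are separated by [z1]. For equal quotients the common power of [q1] cancels,
   and [z2] separates the remainders. *)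
move=> i k ki; have [eq_div|neq_div] := eqVneq (k %/ l2)%N (i %/ l2)%N; last first.
  have div_lt (k' : 'I_(l1 * l2)) : (k' %/ l2 < l1)%N by rewrite ltn_divLR.
  exists true; rewrite /mu (inj_eq (mulIf g1_neq0)) (eq_prim_root_expr q1_prim).
  by rewrite !modn_small // eq_sym.
exists false; rewrite /mu eq_div (inj_eq (mulIf g2_neq0)).
rewrite (inj_eq (mulfI (expf_neq0 _ q1_neq0))) (eq_prim_root_expr q2_prim).
rewrite !modn_mod; apply: contra ki => /eqP eq_mod; apply/eqP/val_inj => /=.
by rewrite (divn_eq k l2) (divn_eq i l2) eq_div eq_mod.
Qed.

(** Simplicity enters as the premise that [v] generates, which keeps the argument free of the
    presented algebra. *)
Lemma qweyl_operators_basis :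
  (forall N : V -> Prop, N v -> N 0 ->
     (forall m m', N m -> N m' -> N (m + m')) ->
     (forall c m, N m -> N (c *: m)) ->
     (forall m, N m -> [/\ N (x1 m), N (y1 m), N (x2 m) & N (y2 m)]) ->
     forall m, N m) ->
  exists e : 'I_(l1 * l2) -> V,
    (forall c : 'I_(l1 * l2) -> K,
       \sum_(i < l1 * l2) c i *: e i = 0 -> forall i, c i = 0) /\
    (forall m, exists c : 'I_(l1 * l2) -> K, m = \sum_(i < l1 * l2) c i *: e i).
Proof.
move=> generated; exists E; split; first exact: E_free.
apply: (generated (lspan E)).
- exact: (eE 0 0).
- exact: lspan0.
- exact: lspanD.
- by move=> c m; exact: lspanZ.
move=> m Em; split; apply: lspan_linear Em => k.
(* The shifts by [x1] and [x2] may leave the range [i < l1], [j < l2]; [eE] covers all indices. *)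
- by rewrite ex1; exact: lspanZ.
- exact: ey1.
- exact: (eE _ (k %% l2).+1).
- exact: ey2.
Qed.

End QweylOperators.

(** * Restriction of scalars from the algebra to the field *)

Section ScalarRestriction.
Variables (K : fieldType) (q1 q2 lam : K).
Local Notation A := (qweyl q1 q2 lam).

Lemma qweyl_scaleAl c (a b : A) : c *: (a * b) = (c *: a) * b.
Proof. exact: pres_scaleAl. Qed.

Lemma qweyl_scaleAr c (a b : A) : c *: (a * b) = a * (c *: b).
Proof. exact: pres_scaleAr. Qed.

Variable M : lmodType A^c.
Implicit Types (m : M) (a b : A) (c d : K).

Lemma ractM m a b : ract m (a * b) = ract (ract m a) b.
Proof. by rewrite /ract scalerA. Qed.

Lemma ract1 m : ract m (1 : A) = m.
Proof. exact: (scale1r m). Qed.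

Lemma ractD m a b : ract m (a + b) = ract m a + ract m b.
Proof. exact: scalerDl. Qed.

Lemma ractB m a b : ract m (a - b) = ract m a - ract m b.
Proof. exact: scalerBl. Qed.

Lemma ractZ m c a : ract m (c *: a) = kscale c (ract m a).
Proof. by rewrite /kscale -ractM -qweyl_scaleAr mulr1. Qed.

Lemma ract_kscale c m a : ract (kscale c m) a = kscale c (ract m a).
Proof. by rewrite -ractZ /kscale -ractM -qweyl_scaleAl mul1r. Qed.

(* A copy of [M] carrying the [K]-vector space structure given by [kscale]. *)
Definition kmod : Type := M.

HB.instance Definition _ := GRing.Zmodule.on kmod.

Fact kscaleA c d m : kscale c (kscale d m) = kscale (c * d) m.
Proof. by rewrite -[m]ract1 -!ractZ scalerA. Qed.

Fact kscale1 : left_id 1 (@kscale K q1 q2 lam M).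
Proof. by move=> m; rewrite /kscale scale1r ract1. Qed.

Fact kscaleDr : right_distributive (@kscale K q1 q2 lam M) +%R.
Proof. by move=> c m m'; exact: scalerDr. Qed.

Fact kscaleDl m : {morph (@kscale K q1 q2 lam M)^~ m : c d / c + d}.
Proof. by move=> c d; rewrite /kscale scalerDl ractD. Qed.

HB.instance Definition _ := GRing.Zmodule_isLmodule.Build K kmod
  kscaleA kscale1 kscaleDr kscaleDl.

(** The algebra element comes first, so that [kract a] can carry the structure of a linear
    endomorphism. *)
Definition kract a : kmod -> kmod := fun m => ract m a.

Fact kract_linear a : linear (kract a).
Proof.
move=> c m m'; rewrite -[c *: kract a m](ract_kscale c m a).
exact: (scalerDr (a : A^c) (kscale c m) m').
Qed.

HB.instance Definition _ a :=
  GRing.isLinear.Build K kmod kmod *:%R (kract a) (kract_linear a).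

Lemma kractM a b (m : kmod) : kract (a * b) m = kract b (kract a m).
Proof. exact: ractM. Qed.

Lemma kractD a b (m : kmod) : kract (a + b) m = kract a m + kract b m.
Proof. exact: ractD. Qed.

Lemma kractB a b (m : kmod) : kract (a - b) m = kract a m - kract b m.
Proof. exact: ractB. Qed.

Lemma kractZ c a (m : kmod) : kract (c *: a) m = c *: kract a m.
Proof. exact: ractZ. Qed.

Lemma kract1 (m : kmod) : kract 1 m = m.
Proof. exact: ract1. Qed.

Lemma kractX a i (m : kmod) : kract (a ^+ i) m = iter i (kract a) m.
Proof.
elim: i => [|i IH]; first by rewrite expr0 kract1.
by rewrite exprSr kractM IH.
Qed.

Local Notation x1 := (x1 q1 q2 lam).
Local Notation y1 := (y1 q1 q2 lam).
Local Notation x2 := (x2 q1 q2 lam).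
Local Notation y2 := (y2 q1 q2 lam).

(** Words in the generators span the algebra, so such an [N] is a submodule; it contains [v], hence
    is not zero. *)
Lemma simple_mod_generated (v : M) : simple_mod M -> v != 0 ->
  forall N : kmod -> Prop, N v -> N 0 ->
     (forall m m', N m -> N m' -> N (m + m')) ->
     (forall c (m : kmod), N m -> N (c *: m)) ->
     (forall m, N m -> [/\ N (kract x1 m), N (kract y1 m),
                           N (kract x2 m) & N (kract y2 m)]) ->
  forall m, N m.
Proof.
move=> [_ M_simple] v_neq0 N Nv N0 ND NZ Ngen.
have N_act a m : N m -> N (kract a m).
  (* The vector stays general: in a product the leading generator acts first and moves [m]. *)
  elim/qweyl_ind: a m => [m|a b IHa IHb m|c a IH m|a IH m|a IH m|a IH m|a IH m] Nm.
  - by rewrite kract1.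
  - by rewrite kractD; apply: ND; [exact: IHa | exact: IHb].
  - by rewrite kractZ; apply: NZ; exact: IH.
  - by rewrite kractM; apply: IH; have [] := Ngen m Nm.
  - by rewrite kractM; apply: IH; have [] := Ngen m Nm.
  - by rewrite kractM; apply: IH; have [] := Ngen m Nm.
  - by rewrite kractM; apply: IH; have [] := Ngen m Nm.
pose P : {pred M} := fun m => `[< N m >].
have P_closed : submod_closed P.
  split=> [|a m m' /asboolP Nm /asboolP Nm']; apply/asboolP; first exact: N0.
  exact: (ND _ _ (N_act a _ Nm) Nm').
case: (M_simple P P_closed) => [P0|PT] m; last exact/asboolP/PT.
by case/eqP: v_neq0; apply/P0/asboolP.
Qed.

End ScalarRestriction.

(** * Passage from the module to the four operators *)

Theorem theorem4p1 (K : closedFieldType) (q1 q2 lam : K) (l1 l2 : nat)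
    (q1_neq0 : q1 != 0) (q1_neq1 : q1 != 1)
    (q2_neq0 : q2 != 0) (q2_neq1 : q2 != 1)
    (lam_neq0 : lam != 0)
    (q1_prim : l1.-primitive_root q1) (q2_prim : l2.-primitive_root q2)
    (lam_l1 : lam ^+ l1 = 1)
    (a1 a2 g1 g2 : K)
    (a1_neq0 : a1 != 0) (a2_neq0 : a2 != 0)
    (g1_neq0 : g1 != 0) (g2_neq0 : g2 != 0)
    (M : lmodType (qweyl q1 q2 lam)^c)
    (M_type : type_M1 M l1 l2 a1 a2 g1 g2) :
  kdim M (l1 * l2).
Proof.
have [M_simple _ _ [v [v_neq0 [vx1 vx2 _ _ [vz1 vz2]]]]] := M_type.
pose X1 := x1 q1 q2 lam.
pose Y1 := y1 q1 q2 lam.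
pose X2 := x2 q1 q2 lam.
pose Y2 := y2 q1 q2 lam.
have x1x2 (m : kmod M) :
    kract X2 (kract X1 m) = (q1 * lam) *: kract X1 (kract X2 m).
  by rewrite -!kractM mul_x1x2 kractZ.
have x1y2 (m : kmod M) : kract Y2 (kract X1 m) = lam^-1 *: kract X1 (kract Y2 m).
  by rewrite -!kractM mul_x1y2 kractZ.
have y1x2 (m : kmod M) :
    kract X2 (kract Y1 m) = (q1^-1 * lam^-1) *: kract Y1 (kract X2 m).
  by rewrite -!kractM mul_y1x2 kractZ.
have x1y1 (m : kmod M) : kract Y1 (kract X1 m) = m + q1 *: kract X1 (kract Y1 m).
  by apply/eqP; rewrite -subr_eq -!kractM -kractZ -kractB mul_x1y1 kract1.
have x2y2 (m : kmod M) : kract Y2 (kract X2 m) =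
    (kract Y1 (kract X1 m) - kract X1 (kract Y1 m)) + q2 *: kract X2 (kract Y2 m).
  have -> : kract Y1 (kract X1 m) - kract X1 (kract Y1 m) =
      m + (q1 - 1) *: kract X1 (kract Y1 m).
    by rewrite x1y1 scalerBl scale1r addrA.
  apply/eqP; rewrite -subr_eq -!kractM -!kractZ -kractB mul_x2y2.
  by rewrite kractD kract1.
have vX1 := etrans (esym (kractX (x1 q1 q2 lam) l1 (v : kmod M))) vx1.
have vX2 := etrans (esym (kractX (x2 q1 q2 lam) l2 (v : kmod M))) vx2.
have vZ1 : kract Y1 (kract X1 v) - kract X1 (kract Y1 v) = g1 *: (v : kmod M).
  by rewrite -!kractM -kractB; exact: vz1.
have vZ2 : kract Y2 (kract X2 v) - kract X2 (kract Y2 v) = g2 *: (v : kmod M).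
  by rewrite -!kractM -kractB; exact: vz2.
(* Scaling in [kmod M] is [kscale] by definition, so the basis obtained is the one required by
   [kdim]. *)
exact: (qweyl_operators_basis q1_neq1 q2_neq1 q1_neq0 lam_neq0
  q1_prim q2_prim a1_neq0 a2_neq0 g1_neq0 g2_neq0 x1x2 x1y2 y1x2 x1y1 x2y2
  v_neq0 vX1 vX2 vZ1 vZ2 (simple_mod_generated M_simple v_neq0)).
Qed.
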